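(* Let $J$ be the objective function defined in the context, let $\Theta\in\mathbb{R}^{Nn_u\times(N+1)n_x}$ and $\Omega:=F(I+H_u\Theta)$. If the terminal covariance satisfies $\Omega\tilde S\Omega^{\mathrm T}\succeq S_d$, then the Hessian of $J$ with respect to $\Theta$, evaluated at this $\Theta$, is positive definite: $\mathrm{Hess}(J)\succ 0$.
   Context: Setting. $N\ge 1$ is an integer (time horizon), $n_x,n_u,n_w\ge 1$, and for $k=0,\dots,N-1$ the matrices $A_k\in\mathbb{R}^{n_x\times n_x}$, $B_k\in\mathbb{R}^{n_x\times n_u}$, $G_k\in\mathbb{R}^{n_x\times n_w}$ are given, with each $G_k$ of full row rank. Also given are $\mu_0,\mu_d\in\mathbb{R}^{n_x}$, symmetric positive definite $S_0,S_d\in\mathbb{R}^{n_x\times n_x}$ and $S_w\in\mathbb{R}^{n_w\times n_w}$, and a real $\lambda>0$. Let $\Phi(n,n)=I$ and $\Phi(k,n)=A_{k-1}\cdots A_n$ for $k>n$. Define $\Gamma=[\,I_{n_x}\;\;\Phi(1,0)^{\mathrm T}\;\cdots\;\Phi(N,0)^{\mathrm T}]^{\mathrm T}\in\mathbb{R}^{(N+1)n_x\times n_x}$; $H_u\in\mathbb{R}^{(N+1)n_x\times Nn_u}$ the block matrix whose block in block-row $i\in\{0,\dots,N\}$ and block-column $j\in\{0,\dots,N-1\}$ is $\Phi(i,j+1)B_j$ if $i>j$ and $0$ otherwise; $H_w\in\mathbb{R}^{(N+1)n_x\times Nn_w}$ defined likewise with $G_j$ in place of $B_j$; $F=[0,\dots,0,I_{n_x}]\in\mathbb{R}^{n_x\times(N+1)n_x}$;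 $\tilde S=\Gamma S_0\Gamma^{\mathrm T}+H_w\,\mathrm{blkdiag}(S_w,\dots,S_w)\,H_w^{\mathrm T}$ (with $N$ copies of $S_w$). For $\Theta\in\mathbb{R}^{Nn_u\times(N+1)n_x}$ put $\Omega=F(I+H_u\Theta)$; the matrix $\Omega\tilde S\Omega^{\mathrm T}$ is the covariance of the terminal state $x_N$. The objective, for $u_{\mathrm{ff}}\in\mathbb{R}^{Nn_u}$, is $$J(u_{\mathrm{ff}},\Theta)=\mathrm{trace}(\Theta\tilde S\Theta^{\mathrm T})+\|u_{\mathrm{ff}}\|_2^2+\lambda\,W_2^2(u_{\mathrm{ff}},\Theta),$$ $$W_2^2(u_{\mathrm{ff}},\Theta)=\|\mu_d-F(\Gamma\mu_0+H_uu_{\mathrm{ff}})\|_2^2+\mathrm{trace}\big(\Omega\tilde S\Omega^{\mathrm T}+S_d\big)-2\,\mathrm{trace}\Big(\big(S_d^{1/2}\,\Omega\tilde S\Omega^{\mathrm T}\,S_d^{1/2}\big)^{1/2}\Big),$$ where $(\cdot)^{1/2}$ is the symmetric positive semidefinite square root. Conventions. $\succeq,\succ$ denote the Löwner order. $\mathrm{vec}$ stacks columns. $\mathrm{Hess}(J)$ is the Hessian with respect to $\Theta$ only (with $u_{\mathrm{ff}}$ fixed), i.e. the Jacobian matrix of $\mathrm{vec}(\partial J/\partial\Theta)$ with respect to $\mathrm{vec}(\Theta)$, all entries of $\Theta$ being treated as independent variables. *)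

(* Defs.v *)
From HB Require Import structures.
From mathcomp Require Import all_boot all_order all_algebra.
From mathcomp Require Import all_classical all_reals all_analysis.
Set Implicit Arguments.
Unset Strict Implicit.
Unset Printing Implicit Defensive.
Import Order.TTheory GRing.Theory Num.Theory.
Import numFieldNormedType.Exports.
Local Open Scope classical_set_scope.
Local Open Scope ring_scope.

Section LoewnerOrder.
Context {R : realType} {n : nat}.
Implicit Types X Y : 'M[R]_n.

Definition possemidef X : Prop :=
  X^T = X /\ forall x : 'cV[R]_n, 0 <= (x^T *m X *m x) 0 0.

Definition posdef X : Prop :=
  X^T = X /\ forall x : 'cV[R]_n, x != 0 -> 0 < (x^T *m X *m x) 0 0.

Definition loewner_ge X Y : Prop := possemidef (X - Y).

(* Junk value 0 when X is not positive semidefinite. *)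
Definition psd_sqrt X : 'M[R]_n :=
  xget 0 [set Y : 'M[R]_n | possemidef Y /\ Y *m Y = X].

End LoewnerOrder.

(* The norm of 'cV[R]_n in the library is the sup norm. *)
Definition sqnorm2 {R : realType} {n : nat} (v : 'cV[R]_n) : R :=
  \sum_i v i 0 ^+ 2.

Section MatrixCalculus.
Context {R : realType} {m n : nat}.

(* mxvec concatenates rows, hence the transposes: vec stacks columns.  The
   result is kept as a row vector, as expected by the library's Jacobian. *)
Definition vec (X : 'M[R]_(m, n)) : 'rV[R]_(n * m) := mxvec X^T.

Definition unvec (v : 'rV[R]_(n * m)) : 'M[R]_(m, n) := (vec_mx v)^T.

Definition gradient (f : 'M[R]_(m, n) -> R) (X : 'M[R]_(m, n)) :
    'M[R]_(m, n) :=
  \matrix_(i, j) 'D_(delta_mx i j) f X.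

Definition vec_gradient (f : 'M[R]_(m, n) -> R) (v : 'rV[R]_(n * m)) :
    'rV[R]_(n * m) :=
  vec (gradient f (unvec v)).

(* 'J g p acts on row vectors from the right, so it is the transpose of the
   usual Jacobian matrix of g. *)
Definition Hess (f : 'M[R]_(m, n) -> R) (X : 'M[R]_(m, n)) : 'M[R]_(n * m) :=
  ('J (vec_gradient f) (vec X))^T.

(* Without these conditions the derivatives above are junk values. *)
Definition twice_differentiable (f : 'M[R]_(m, n) -> R) (X : 'M[R]_(m, n)) :
    Prop :=
  (\forall Y \near X, differentiable f Y) /\
  differentiable (vec_gradient f) (vec X).

End MatrixCalculus.

Section CovarianceSteering.
Context {R : realType} {N nx nu nw : nat}.

(* Phi A k n = A_(k-1) *m ... *m A_n, and the identity if k = n. *)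
Definition Phi (A : 'I_N -> 'M[R]_nx) (k n : nat) : 'M[R]_nx :=
  \big[mulmx/1%:M]_(l <- rev (enum 'I_N) | (n <= l < k)%N) A l.

Definition Gamma (A : 'I_N -> 'M[R]_nx) :
    'M[R]_(\sum_(i < N.+1) nx, nx) :=
  \mxcol_(i < N.+1) Phi A i 0%N.

(* H_u is Hmx A B and H_w is Hmx A G. *)
Definition Hmx {p : nat} (A : 'I_N -> 'M[R]_nx) (B : 'I_N -> 'M[R]_(nx, p)) :
    'M[R]_(\sum_(i < N.+1) nx, \sum_(j < N) p) :=
  \mxblock_(i < N.+1, j < N)
    (if (j < i)%N then Phi A i j.+1 *m B j else 0).

Definition Fmx : 'M[R]_(nx, \sum_(i < N.+1) nx) :=
  \mxrow_(i < N.+1) (if i == ord_max then 1%:M else 0).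

Definition Stilde (A : 'I_N -> 'M[R]_nx) (G : 'I_N -> 'M[R]_(nx, nw))
    (S0 : 'M[R]_nx) (Sw : 'M[R]_nw) : 'M[R]_(\sum_(i < N.+1) nx) :=
  Gamma A *m S0 *m (Gamma A)^T
  + Hmx A G *m (\mxdiag_(j < N) Sw) *m (Hmx A G)^T.

Definition Omega (A : 'I_N -> 'M[R]_nx) (B : 'I_N -> 'M[R]_(nx, nu))
    (Theta : 'M[R]_(\sum_(j < N) nu, \sum_(i < N.+1) nx)) :
    'M[R]_(nx, \sum_(i < N.+1) nx) :=
  Fmx *m (1%:M + Hmx A B *m Theta).

Definition terminal_cov (A : 'I_N -> 'M[R]_nx) (B : 'I_N -> 'M[R]_(nx, nu))
    (G : 'I_N -> 'M[R]_(nx, nw)) (S0 : 'M[R]_nx) (Sw : 'M[R]_nw)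
    (Theta : 'M[R]_(\sum_(j < N) nu, \sum_(i < N.+1) nx)) : 'M[R]_nx :=
  Omega A B Theta *m Stilde A G S0 Sw *m (Omega A B Theta)^T.

Definition W2sq (A : 'I_N -> 'M[R]_nx) (B : 'I_N -> 'M[R]_(nx, nu))
    (G : 'I_N -> 'M[R]_(nx, nw)) (mu0 mud : 'cV[R]_nx)
    (S0 Sd : 'M[R]_nx) (Sw : 'M[R]_nw)
    (uff : 'cV[R]_(\sum_(j < N) nu))
    (Theta : 'M[R]_(\sum_(j < N) nu, \sum_(i < N.+1) nx)) : R :=
  let C := terminal_cov A B G S0 Sw Theta in
  sqnorm2 (mud - Fmx *m (Gamma A *m mu0 + Hmx A B *m uff))
  + \tr (C + Sd)
  - 2 * \tr (psd_sqrt (psd_sqrt Sd *m C *m psd_sqrt Sd)).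

Definition J (A : 'I_N -> 'M[R]_nx) (B : 'I_N -> 'M[R]_(nx, nu))
    (G : 'I_N -> 'M[R]_(nx, nw)) (mu0 mud : 'cV[R]_nx)
    (S0 Sd : 'M[R]_nx) (Sw : 'M[R]_nw) (lambda : R)
    (uff : 'cV[R]_(\sum_(j < N) nu))
    (Theta : 'M[R]_(\sum_(j < N) nu, \sum_(i < N.+1) nx)) : R :=
  \tr (Theta *m Stilde A G S0 Sw *m Theta^T) + sqnorm2 uff
  + lambda * W2sq A B G mu0 mud S0 Sd Sw uff Theta.

End CovarianceSteering.

(* Main.v *)
Require Import Defs.
From HB Require Import structures.
From mathcomp Require Import all_boot all_order all_algebra.
From mathcomp Require Import all_classical all_reals all_analysis.
From mathcomp Require Import complex.
From mathcomp Require Import ring lra.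
Set Implicit Arguments.
Unset Strict Implicit.
Unset Printing Implicit Defensive.
Import Order.TTheory GRing.Theory Num.Theory.
Import numFieldNormedType.Exports.
Local Open Scope classical_set_scope.
Local Open Scope ring_scope.

(** Up to additive constants, the objective is
    tr(Theta S Theta^T) + lambda (tr C - 2 tr P), where Omega = F + K Theta with
    K = F H_u, C = Omega S Omega^T is the terminal covariance, D = Sd^(1/2), and
    P = (D C D)^(1/2).

    First order.  Near a positive definite matrix M the square root is
    differentiable, and its differential sends Z to the solution L of the
    Lyapunov equation M^(1/2) L + L M^(1/2) = Z ([is_diff_psd_sqrt]).
    Multiplying this equation by M^(-1/2) and taking traces yields
    2 tr L = tr(M^(-1/2) Z).  Hence the gradient of the objective is
    2 (Theta S + lambda K^T Omega S - lambda K^T D P^-1 D Omega S) wherever C is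
    positive definite, in particular near the given Theta, where C >= Sd.

    Second order.  Differentiating once more in the direction V, and writing
    E = K V, T = D P^-1 D and L for the differential of P along V, one finds the
    quadratic form
      2 tr(V S V^T) + 2 lambda tr((1 - T) E S E^T) + 2 lambda tr(P^-1 L^2).
    The first term is positive for V != 0 because S is positive definite
    ([Stilde_posdef]: the noise reaches every state because each G_k has full
    row rank).  The last one is nonnegative because L is symmetric.  The middle
    one is nonnegative because T <= 1 ([transport_contraction]): T is the
    optimal transport map from covariance C to covariance Sd, that is,
    T C T = Sd, so an eigenvector v of T with eigenvalue t satisfies
    t^2 v^T C v = v^T Sd v <= v^T C v, whence t <= 1.
    The Hessian is symmetric because the polarized form
    ([second_variation]) visibly is.

    The differentiability of the square root rests on an explicit estimate.
    If Q^2 = M and P^2 = M0 with Q >= 0 and P > 0, the difference Y = Q - P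
    solves P Y + Y Q = M - M0; pairing this equation with Y bounds Y by a
    constant times M - M0 ([lyapunov_bound]).  If L solves
    P L + L P = M - M0, then the error Y - L solves the Lyapunov equation of P
    with right-hand side - Y^2, so it is quadratic in M - M0
    ([psd_sqrt_expansion]). *)

(** * Spectral theory of real symmetric matrices *)

Section SpectralTheory.
Context {R : realType}.

Lemma interpolation (s : seq R) (f : R -> R) :
  exists p : {poly R}, forall d, d \in s -> p.[d] = f d.
Proof.
elim: s => [|a s [p pE]]; first by exists 0.
have [as_|aNs] := boolP (a \in s).
  by exists p => d; rewrite inE => /predU1P[->|]; [exact: pE|exact: pE].
pose q := \prod_(b <- s) ('X - b%:P) : {poly R}.
have qa : q.[a] != 0 by rewrite -rootE root_prod_XsubC.
exists (p + ((f a - p.[a]) / q.[a]) *: q) => d.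
rewrite inE => /predU1P[->|ds]; rewrite !hornerE.
  by rewrite divfK// addrC subrK.
have /rootP -> : root q d by rewrite root_prod_XsubC.
by rewrite mulr0 addr0 pE.
Qed.

(** The spectral theorem in polynomial form.  The complexification of [A] is
    Hermitian, so it is diagonalized by a unitary matrix and its eigenvalues are
    real; a polynomial that vanishes at all of them vanishes at the diagonal
    form, hence at [A]. *)
Lemma symmetric_horner_eq0 n (A : 'M[R]_n.+1) : A^T = A ->
  exists2 s : seq R, {in s, forall a, eigenvalue A a} &
    forall p : {poly R}, {in s, forall a, p.[a] = 0} -> horner_mx A p = 0.
Proof.
move=> symA; pose f : {rmorphism R -> R[i]} := real_complex R.
pose A' := map_mx f A.
have reA' : A' \is a mxOver Num.real.
  by apply/mxOverP => i j; rewrite mxE complex_real.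
have symA' : A'^T = A' by rewrite /A' map_trmx symA.
have hermA' : A' \is hermsymmx.
  apply: realsym_hermsym reA'; apply/is_hermitianmxP.
  by rewrite expr0 scale1r map_mx_id.
pose P := spectralmx A'; pose d := spectral_diag A'.
have Pu : P \in unitmx := spectral_unit A'.
have A'E : A' = invmx P *m diag_mx d *m P.
  exact/orthomx_spectralP/hermitian_normalmx.
have dE i : f (complex.Re (d 0 i)) = d 0 i.
  have /mxOverP/(_ 0 i) := hermitian_spectral_diag_real hermA'.
  by rewrite -/d => /complex_realP[r ->].
exists [seq complex.Re (d 0 i) | i <- enum 'I_n.+1].
  move=> _ /mapP[i _ ->]; rewrite eigenvalue_root_char -(fmorph_root f).
  rewrite map_char_poly dE -eigenvalue_root_char; apply/eigenvalueP.
  exists (row i P).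
    rewrite -/A' A'E -row_mul -mulmxA mulKVmx// row_mul row_diag_mx.
    by rewrite -scalemxAl -rowE.
  apply/eqP => rowP0.
  have /eqP := row_mul i P (invmx P); rewrite rowP0 mul0mx mulmxV//.
  by move/eqP/matrixP/(_ 0 i); rewrite !mxE eqxx => /eqP; rewrite oner_eq0.
move=> p p0; apply: (map_mx_inj (f := f)) => /=.
rewrite map_horner_mx map_mx0 -/A' A'E (horner_mx_uconjC _ _ Pu) horner_mx_diag.
rewrite (_ : map_mx _ _ = 0) ?linear0 ?mulmx0 ?mul0mx//.
apply/rowP => i; rewrite !mxE -dE horner_map p0 ?rmorph0//.
by apply/mapP; exists i; rewrite ?mem_enum.
Qed.

Lemma trmx_horner_mx n (A : 'M[R]_n.+1) p : (horner_mx A p)^T = horner_mx A^T p.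
Proof.
elim/poly_ind: p => [|p c IHp]; first by rewrite !rmorph0 linear0.
rewrite !rmorphD !rmorphM /= !horner_mx_X !horner_mx_C linearD /= trmx_mul IHp.
rewrite tr_scalar_mx; congr (_ + _).
exact: (comm_mx_horner p (comm_mx_refl _)).
Qed.

Lemma possemidef_gram m n (B : 'M[R]_(m, n)) : possemidef (B^T *m B).
Proof.
split=> [|x]; first by rewrite trmx_mul trmxK.
rewrite mulmxA -trmx_mul -mulmxA mxE sumr_ge0// => i _.
by rewrite mxE -expr2 sqr_ge0.
Qed.

Lemma possemidef_congr m n (A : 'M[R]_m) (B : 'M[R]_(m, n)) :
  possemidef A -> possemidef (B^T *m A *m B).
Proof.
move=> [symA A0]; split=> [|x]; first by rewrite !trmx_mul trmxK symA mulmxA.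
have := A0 (B *m x); rewrite trmx_mul !mulmxA; apply.
Qed.

Lemma posdef_psd n (A : 'M[R]_n) : posdef A -> possemidef A.
Proof.
move=> [symA A0]; split=> // x; have [->|x0] := eqVneq x 0.
  by rewrite mulmx0 mxE.
exact/ltW/A0.
Qed.

Lemma possemidef_eigenvalue n (A : 'M[R]_n) a :
  possemidef A -> eigenvalue A a -> 0 <= a.
Proof.
move=> [_ A0] /eigenvalueP[v vA v0].
have := A0 v^T; rewrite trmxK vA -scalemxAl mxE.
suff : 0 < (v *m v^T) 0 0 by move=> ?; rewrite pmulr_lge0.
rewrite mxE lt0r psumr_eq0 => [|i _]; last by rewrite mxE -expr2 sqr_ge0.
rewrite sumr_ge0 ?andbT => [|i _]; last by rewrite mxE -expr2 sqr_ge0.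
apply: contra v0 => /allP v0; apply/eqP/rowP => i.
have := v0 i (mem_index_enum i); rewrite /= !mxE mulf_eq0 orbb.
by move/eqP.
Qed.

(** The square root is a polynomial in [A].  Interpolating the fourth root of
    the eigenvalues, rather than their square root, makes the result the square
    of a symmetric matrix, so its positivity is immediate. *)
Lemma symmetric_sqrt n (A : 'M[R]_n) : A^T = A ->
    (forall a, eigenvalue A a -> 0 <= a) ->
  exists Q : 'M[R]_n, possemidef Q /\ Q *m Q = A.
Proof.
(* Matrices form a ring, in which polynomials are evaluated, only in positive
   dimension. *)
case: n A => [|n] A symA A0.
  exists (A^T *m A); split; first exact: possemidef_gram.
  by apply/matrixP => -[].
have [s sA sE] := symmetric_horner_eq0 symA.
have [r rE] := interpolation s (fun a => Num.sqrt (Num.sqrt a)).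
pose B := horner_mx A r.
have symB : B^T = B by rewrite trmx_horner_mx symA.
exists (B^T *m B); split; first exact: possemidef_gram.
apply/eqP; rewrite symB -subr_eq0; apply/eqP.
have -> : B *m B *m (B *m B) - A = horner_mx A (r ^+ 2 * r ^+ 2 - 'X).
  by rewrite rmorphB rmorphM !rmorphXn /= horner_mx_X !expr2.
apply: sE => a /[dup] /sA/A0 a0 /rE ra.
rewrite hornerD hornerN hornerX hornerM horner_exp ra.
by rewrite !sqr_sqrtr ?sqrtr_ge0// -expr2 sqr_sqrtr// subrr.
Qed.

Lemma possemidefP n (A : 'M[R]_n) : A^T = A ->
  (forall a, eigenvalue A a -> 0 <= a) -> possemidef A.
Proof.
move=> symA /(symmetric_sqrt symA)[Q [[symQ _] <-]].
by rewrite -{1}symQ; exact: possemidef_gram.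
Qed.

Lemma psd_sqrtP n (A : 'M[R]_n) : possemidef A ->
  possemidef (psd_sqrt A) /\ psd_sqrt A *m psd_sqrt A = A.
Proof.
move=> A0; apply: (@xgetPex _ 0 [set Y : 'M[R]_n | possemidef Y /\ Y *m Y = A]).
apply: symmetric_sqrt => [|a]; first by case: A0.
exact: possemidef_eigenvalue.
Qed.

Lemma gram_eq0 m n (B : 'M[R]_(m, n)) : \tr (B^T *m B) = 0 -> B = 0.
Proof.
rewrite /mxtrace => /eqP; rewrite psumr_eq0 => [|j _]; last first.
  by rewrite mxE sumr_ge0// => i _; rewrite mxE -expr2 sqr_ge0.
move=> /allP B0; apply/matrixP => i j.
have := B0 j (mem_index_enum j); rewrite /= mxE psumr_eq0 => [|k _]; last first.
  by rewrite mxE -expr2 sqr_ge0.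
move=> /allP/(_ i (mem_index_enum i)); rewrite /= !mxE mulf_eq0 orbb.
by move/eqP.
Qed.

Lemma possemidef_unit n (A : 'M[R]_n) :
  possemidef A -> A \in unitmx -> posdef A.
Proof.
move=> A0 uA; have [[symQ _] QA] := psd_sqrtP A0.
split=> [|x x0]; first by case: A0.
rewrite lt0r (A0.2 x) andbT; apply: contra x0 => /eqP xAx.
have Qx0 : psd_sqrt A *m x = 0.
  apply: gram_eq0; rewrite trmx_mul symQ mulmxA -(mulmxA x^T) QA.
  by rewrite /mxtrace big_ord1.
by rewrite -[x](mulKmx uA) -{2}QA -mulmxA Qx0 !mulmx0.
Qed.

Lemma posdef_unit n (A : 'M[R]_n) : posdef A -> A \in unitmx.
Proof.
move=> [symA A0]; rewrite -row_free_unit -kermx_eq0; apply/eqP/row_matrixP => i.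
rewrite row0; apply/eqP; apply: contraT => v0.
have : row i (kermx A) *m A = 0 by rewrite -row_mul mulmx_ker row0.
move: (row i _) v0 => v v0 vA.
have := A0 v^T; rewrite trmxK vA mul0mx mxE ltxx trmx_eq0.
by move=> /(_ v0).
Qed.

Lemma psd_sqrt_posdef n (A : 'M[R]_n) : posdef A -> posdef (psd_sqrt A).
Proof.
move=> pA; have [Q0 QA] := psd_sqrtP (posdef_psd pA).
apply: possemidef_unit Q0 _.
by have := posdef_unit pA; rewrite -{1}QA unitmx_mul => /andP[].
Qed.

Lemma posdef_congr m n (A : 'M[R]_m) (B : 'M[R]_(m, n)) :
  posdef A -> (forall x : 'cV_n, B *m x = 0 -> x = 0) ->
  posdef (B^T *m A *m B).
Proof.
move=> [symA A0] B0; split=> [|x x0].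
  by rewrite !trmx_mul trmxK symA mulmxA.
have := A0 (B *m x); rewrite trmx_mul !mulmxA; apply.
by apply: contra_neq x0; exact: B0.
Qed.

Lemma posdef_inv n (A : 'M[R]_n) : posdef A -> posdef (invmx A).
Proof.
move=> pA; have uA := posdef_unit pA; have [symA _] := pA.
have -> : invmx A = (invmx A)^T *m A *m invmx A.
  by rewrite -mulmxA mulmxV// mulmx1 trmx_inv symA.
apply: posdef_congr pA _ => x Ax0.
by rewrite -[x](mulKVmx uA) Ax0 mulmx0.
Qed.

Lemma mxtrace_possemidef_ge0 n (A : 'M[R]_n) : possemidef A -> 0 <= \tr A.
Proof.
move=> [_ A0]; apply: sumr_ge0 => i _.
have := A0 (delta_mx i 0).
by rewrite trmx_delta -mulmxA -colE -rowE !mxE.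
Qed.

(** With [Q] the square root of [B], this is the trace of [Q *m A *m Q]. *)
Lemma mxtrace_mul_psd_ge0 n (A B : 'M[R]_n) :
  possemidef A -> possemidef B -> 0 <= \tr (A *m B).
Proof.
move=> A0 B0; have [[symQ _] <-] := psd_sqrtP B0.
rewrite mulmxA mxtrace_mulC mulmxA -{1}symQ.
exact/mxtrace_possemidef_ge0/possemidef_congr.
Qed.
End SpectralTheory.

(** * Estimates for the entrywise maximum norm *)

Section MatrixNorm.
Context {R : realType}.

Lemma ler_norm_entry m n (A : 'M[R]_(m, n)) i j : `|A i j| <= `|A|.
Proof.
rewrite [leRHS]/Num.norm/= mx_normrE.
exact: (le_bigmax_cond _ (fun ij : 'I_m * 'I_n => `|A ij.1 ij.2|)
  (j := (i, j))).
Qed.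

Lemma mx_norm_le m n (A : 'M[R]_(m, n)) c : 0 <= c ->
  (forall i j, `|A i j| <= c) -> `|A| <= c.
Proof.
move=> c0 Ac; rewrite [leLHS]/Num.norm/= mx_normrE.
by apply/bigmax_leP; split=> // -[i j] _; exact: Ac.
Qed.

Lemma ler_norm_mulmx m n p (A : 'M[R]_(m, n)) (B : 'M[R]_(n, p)) :
  `|A *m B| <= n%:R * `|A| * `|B|.
Proof.
apply: mx_norm_le => [|i j]; first by rewrite !mulr_ge0.
rewrite mxE (le_trans (ler_norm_sum _ _ _))//.
rewrite -mulrA mulr_natl -[X in _ *+ X]card_ord -sumr_const ler_sum// => k _.
by rewrite normrM ler_pM// ler_norm_entry.
Qed.

Lemma sqr_norm_le_gram m n (A : 'M[R]_(m, n)) : `|A| ^+ 2 <= \tr (A^T *m A).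
Proof.
have tr_ge0 : 0 <= \tr (A^T *m A).
  exact/mxtrace_possemidef_ge0/possemidef_gram.
rewrite -(sqr_sqrtr tr_ge0) ler_sqr ?nnegrE ?sqrtr_ge0//.
apply: mx_norm_le => [|i j]; first exact: sqrtr_ge0.
rewrite -sqrtr_sqr ler_wsqrtr// /mxtrace (bigD1 j)//= mxE (bigD1 i)//= !mxE.
rewrite -expr2 -addrA lerDl addr_ge0//.
  by apply: sumr_ge0 => k _; rewrite !mxE -expr2 sqr_ge0.
apply: sumr_ge0 => k _; rewrite mxE; apply: sumr_ge0 => l _.
by rewrite !mxE -expr2 sqr_ge0.
Qed.

Lemma mxtrace_mul_le m n (A B : 'M[R]_(m, n)) :
  \tr (A^T *m B) <= n%:R * (m%:R * `|A| * `|B|).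
Proof.
rewrite mulr_natl -[X in _ *+ X]card_ord -sumr_const ler_sum// => j _.
rewrite mxE -mulrA mulr_natl -[X in _ *+ X]card_ord -sumr_const.
rewrite ler_sum// => i _.
by rewrite mxE (le_trans (ler_norm _))// normrM ler_pM// ler_norm_entry.
Qed.

(** With [Q] the square root of [A], the trace is the squared Frobenius norm of
    [Q *m Y], and [Y] is recovered from [Q *m Y] by the invertible [Q]. *)
Lemma posdef_coercive n (A : 'M[R]_n) : posdef A ->
  exists2 c : R, 0 < c &
    forall p (Y : 'M[R]_(n, p)), c * `|Y| ^+ 2 <= \tr (Y^T *m A *m Y).
Proof.
move=> pA; have [[symQ _] QA] := psd_sqrtP (posdef_psd pA).
have uQ := posdef_unit (psd_sqrt_posdef pA).
move: (psd_sqrt A) symQ QA uQ => Q symQ QA uQ.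
pose k := n%:R * `|invmx Q| + 1.
have k0 : 0 < k by rewrite ltr_wpDl// mulr_ge0.
exists (k ^- 2) => [|p Y]; first by rewrite invr_gt0 exprn_gt0.
rewrite ler_pdivrMl ?exprn_gt0//.
have -> : Y^T *m A *m Y = (Q *m Y)^T *m (Q *m Y).
  by rewrite trmx_mul symQ -QA !mulmxA.
apply: le_trans (ler_wpM2l (ltW (exprn_gt0 _ k0)) (sqr_norm_le_gram _)).
rewrite -exprMn ler_sqr ?nnegrE ?mulr_ge0 ?(ltW k0)//.
rewrite -{1}[Y](mulKmx uQ) (le_trans (ler_norm_mulmx _ _))//.
by rewrite ler_wpM2r// lerDl.
Qed.

End MatrixNorm.

(** * Differentials of matrix-valued functions *)

Section MatrixDifferential.
Context {R : realType}.
Implicit Types V W : normedModType R.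

(** Every differential that does not come from linear maps and products is
    obtained here from a first-order expansion with quadratic remainder. *)
Lemma is_diff_quadratic V W (f : V -> W) (L : {linear V -> W}) x k :
  continuous L ->
  (\forall h \near 0, `|f (h + x) - f x - L h| <= k * `|h| ^+ 2) ->
  is_diff x f L.
Proof.
move=> cL fL.
have fE : f \o shift x = cst (f x) + L +o_ 0 id.
  apply/eqaddoP => e e0; near=> h.
  rewrite !fctE /= opprD addrA.
  apply: (@le_trans _ _ (k * `|h| ^+ 2)); first by near: h.
  rewrite expr2 mulrA ler_wpM2r//.
  apply: (@le_trans _ _ ((`|k| + 1) * `|h|)).
    by rewrite ler_wpM2r// (le_trans (ler_norm _))// lerDl.
  rewrite -ler_pdivlMl ?ltr_wpDl//.
  near: h; rewrite near_simpl.
  apply/nbhs0_le; rewrite mulr_gt0 ?invr_gt0 ?ltr_wpDl//.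
have dE := diff_unique cL fE.
apply: DiffDef => //; apply/diff_locallyP; rewrite dE; split=> //.
Unshelve. all: by end_near. Qed.

(** The difference of the two functions vanishes near [x], so its differential
    is zero. *)
Lemma near_eq_is_diff V W (f g dg : V -> W) x :
  (\near x, f x = g x) -> is_diff x g dg -> is_diff x f dg.
Proof.
move=> fg gx.
have d0 : is_diff x (f - g) (\0 : {linear V -> W}).
  apply: (@is_diff_quadratic _ _ _ _ _ 0); first exact: cst_continuous.
  have fgx : f x = g x by exact: nbhs_singleton fg.
  move: fg => /nbhs0P fg; near=> h.
  rewrite !fctE fgx subrr subr0 [h + x]addrC.
  by rewrite (near fg h)// subrr subr0 normr0 mul0r.
have -> : f = g + (f - g) by rewrite addrC subrK.
apply: (is_diff_eq (is_diffD gx d0)).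
by rewrite funeqE => h; rewrite !fctE /= addr0.
Unshelve. all: by end_near. Qed.

Lemma is_diff_lipschitz V W (f df : V -> W) x : is_diff x f df ->
  exists2 k : R, 0 < k & \forall h \near 0, `|f (h + x) - f x| <= k * `|h|.
Proof.
move=> [dfx _].
have [k k0 kP] := linear_lipschitz (diff_continuous dfx).
exists (k + 1); first by rewrite addr_gt0.
have /diff_locallyP[_ /eqaddoP/(_ 1 ltr01)] := dfx.
move=> fP; near=> h.
rewrite -[_ - _](subrK ('d f x h)) (le_trans (ler_normD _ _))// mulrDl addrC.
by rewrite lerD// -addrA -opprD; near: h.
Unshelve. all: by end_near. Qed.

Lemma matrix_linear_continuous m n W (f : {linear 'M[R]_(m, n) -> W}) :
  continuous f.
Proof.
apply: bounded_linear_continuous; apply/linear_boundedP.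
exists (\sum_i \sum_j `|f (delta_mx i j)|); split; first exact: num_real.
move=> r /ltW kr M; rewrite {1}[M]matrix_sum_delta.
apply: le_trans (ler_wpM2r _ kr) => //.
rewrite linear_sum (le_trans (ler_norm_sum _ _ _))// mulr_suml ler_sum// => i _.
rewrite linear_sum (le_trans (ler_norm_sum _ _ _))// mulr_suml ler_sum// => j _.
by rewrite linearZ normrZ mulrC ler_wpM2l// ler_norm_entry.
Qed.

Lemma is_diff_linear m n W (f : {linear 'M[R]_(m, n) -> W}) x : is_diff x f f.
Proof.
have cf := @matrix_linear_continuous _ _ _ f.
by apply: DiffDef; [exact: linear_differentiable|rewrite diff_lin].
Qed.

Lemma is_diff_trace V m (f df : V -> 'M[R]_m) x :
  is_diff x f df -> is_diff x (fun t => \tr (f t)) (fun h => \tr (df h)).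
Proof.
by move=> fx; exact: (is_diff_comp fx (is_diff_linear (@mxtrace R m) (f x))).
Qed.

(** Leibniz rule: the product differs from its linearization by
    [(f t - f x) *m (g t - g x)], which is quadratically small. *)
Lemma is_diff_mulmx V m n p (f df : V -> 'M[R]_(m, n))
    (g dg : V -> 'M[R]_(n, p)) x :
  is_diff x f df -> is_diff x g dg ->
  is_diff x (fun t => f t *m g t) (fun h => df h *m g x + f x *m dg h).
Proof.
move=> fx gx.
have [kf kf0 fP] := is_diff_lipschitz fx.
have [kg kg0 gP] := is_diff_lipschitz gx.
pose r t := (f t - f x) *m (g t - g x).
have dr : is_diff x r (\0 : {linear V -> 'M[R]_(m, p)}).
  apply: (@is_diff_quadratic _ _ _ _ _ (n%:R * kf * kg)).
    exact: cst_continuous.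
  near=> h; rewrite /r !subrr mulmx0 !subr0 (le_trans (ler_norm_mulmx _ _))//.
  rewrite -mulrA (_ : _ * `|h| ^+ 2 = n%:R * ((kf * `|h|) * (kg * `|h|))).
    by rewrite ler_wpM2l// ler_pM//; near: h.
  by rewrite expr2; ring.
have -> : (fun t => f t *m g t) =
    (mulmxr (g x) \o f) + (mulmx (f x) \o g) + (r - cst (f x *m g x)).
  have E (a b c d : 'M[R]_(m, p)) : a = b + c + (a - b - (c - d) - d).
    by apply/matrixP => i j; rewrite !mxE; ring.
  by rewrite funeqE => t; rewrite !fctE /= /r mulmxBl !mulmxBr; exact: E.
have dl := is_diff_linear (mulmxr (g x)) (f x).
have dg' := is_diff_linear (mulmx (f x)) (g x).
apply: (is_diff_eq (is_diffD
  (is_diffD (is_diff_comp fx dl) (is_diff_comp gx dg'))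
  (is_diffB dr (is_diff_cst _ _)))).
by rewrite funeqE => h; rewrite !fctE /= [_ - _]subr0 addr0.
Unshelve. all: by end_near. Qed.

Lemma mulmx_inv_sub n (A B : 'M[R]_n) : A \in unitmx ->
  invmx A *m (B - A) = invmx A *m B - 1%:M.
Proof. by move=> uA; rewrite mulmxBr mulVmx. Qed.

(** Neumann-series bound: multiplication by [invmx A *m (B - A)] shrinks norms
    by a factor of at least two.  Applied to a matrix annihilated by [B] it
    gives invertibility; applied to [invmx B] it gives the norm bound. *)
Lemma unitmx_perturbation n (A B : 'M[R]_n) : A \in unitmx ->
    n%:R * n%:R * `|invmx A| * `|B - A| <= 2^-1 ->
  B \in unitmx /\ `|invmx B| <= 2 * `|invmx A|.
Proof.
move=> uA cB; set Y := invmx A in cB *.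
have small m (M : 'M[R]_(n, m)) : `|Y *m (B - A) *m M| <= `|M| / 2.
  rewrite (le_trans (ler_norm_mulmx _ _))// mulrC ler_wpM2l//.
  apply: le_trans cB; rewrite -!mulrA ler_wpM2l//.
  by rewrite mulrA ler_norm_mulmx.
have uB : B \in unitmx.
  rewrite -unitmx_tr -row_free_unit -kermx_eq0.
  apply/eqP; set M := (kermx B^T)^T; apply: trmx_inj; rewrite trmx0 -/M.
  have BM0 : B *m M = 0.
    by apply: trmx_inj; rewrite trmx_mul trmxK mulmx_ker trmx0.
  have := small _ M; rewrite mulmx_inv_sub// mulmxBl -mulmxA BM0 mulmx0 mul1mx.
  by rewrite sub0r normrN => ?; apply/eqP; rewrite -normr_le0; lra.
split=> //; have := small _ (invmx B).
rewrite mulmx_inv_sub// mulmxBl mulmxK// mul1mx => YB.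
by have := ler_normB Y (Y - invmx B); rewrite subKr; lra.
Qed.

Lemma near_unitmx_perturbation n (A : 'M[R]_n) :
  \forall H \near (0 : 'M[R]_n), n%:R * n%:R * `|invmx A| * `|H| <= 2^-1.
Proof.
set c := n%:R * n%:R * _; have c0 : 0 <= c by rewrite !mulr_ge0.
near=> H; apply: (@le_trans _ _ ((c + 1) * `|H|)).
  by rewrite ler_wpM2r// lerDl.
rewrite -ler_pdivlMl ?ltr_wpDl//; near: H; rewrite near_simpl; apply: nbhs0_le.
by rewrite mulr_gt0// ?invr_gt0 ltr_wpDl.
Unshelve. all: by end_near. Qed.

Lemma near_unitmx n (A : 'M[R]_n) : A \in unitmx ->
  \forall B \near A, B \in unitmx.
Proof.
move=> uA; apply/nbhs0P; near=> H.
have [] // := @unitmx_perturbation _ A (A + H) uA.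
rewrite [A + H]addrC addrK; near: H; exact: near_unitmx_perturbation.
Unshelve. all: by end_near. Qed.

(** Iterating the identity [invmx B - invmx A = - invmx A *m (B - A) *m invmx B]
    once leaves a remainder that is quadratic in [B - A], as [invmx B] stays
    bounded near [A]. *)
Lemma is_diff_mx_invmx n (A : 'M[R]_n) : A \in unitmx ->
  is_diff A invmx (fun H => - (invmx A *m H *m invmx A)).
Proof.
move=> uA; set Y := invmx A.
pose L : {linear 'M[R]_n -> 'M[R]_n} := mulmx (- Y) \o mulmxr Y.
have -> : (fun H => - (Y *m H *m Y)) = L.
  by rewrite funeqE => H /=; rewrite mulNmx mulmxA.
pose c := n%:R * n%:R * `|Y|.
apply: (@is_diff_quadratic _ _ _ _ _ (c * c * (2 * `|Y|))).
  exact: matrix_linear_continuous.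
near=> H; have [|uH iH] := @unitmx_perturbation _ A (H + A) uA.
  by rewrite addrK; near: H; exact: near_unitmx_perturbation.
have -> : invmx (H + A) - Y - L H = Y *m H *m (Y *m H *m invmx (H + A)).
  have YHE : Y *m H *m invmx (H + A) = Y - invmx (H + A).
    by rewrite -[H in Y *m H](addrK A) mulmx_inv_sub// mulmxBl mulmxK// mul1mx.
  by rewrite YHE mulmxBr YHE /L /= mulNmx opprK mulmxA opprB addrC.
have YH := ler_norm_mulmx Y H; set t := n%:R * _ * _ in YH.
apply: (@le_trans _ _ (n%:R * t * (n%:R * t * (2 * `|Y|)))); last first.
  by rewrite /c /t expr2; lra.
rewrite (le_trans (ler_norm_mulmx _ _))// ler_pM ?mulr_ge0 ?ler_wpM2l//.
by rewrite (le_trans (ler_norm_mulmx _ _))// ler_pM ?mulr_ge0 ?ler_wpM2l.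
Unshelve. all: by end_near. Qed.

Lemma is_diff_invmx V n (f df : V -> 'M[R]_n) x : f x \in unitmx ->
  is_diff x f df ->
  is_diff x (fun t => invmx (f t))
    (fun h => - (invmx (f x) *m df h *m invmx (f x))).
Proof. by move=> /is_diff_mx_invmx ifx fx; exact: (is_diff_comp fx ifx). Qed.

End MatrixDifferential.

(** * The Lyapunov equation and the differential of the square root *)

Section SquareRootDifferential.
Context {R : realType}.

Section Lyapunov.
Context {n : nat}.
Implicit Types A B Y Z : 'M[R]_n.

(** Pairing [A *m Y + Y *m B] with [Y] in the trace inner product gives
    [\tr (Y^T *m A *m Y) + \tr (Y^T *m Y *m B)], and the second trace is
    nonnegative. *)
Lemma lyapunov_bound A c :
    (forall p (Y : 'M[R]_(n, p)), c * `|Y| ^+ 2 <= \tr (Y^T *m A *m Y)) ->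
  forall B Y, possemidef B -> c * `|Y| <= n%:R * n%:R * `|A *m Y + Y *m B|.
Proof.
move=> Ac B Y B0; have [->|Y0] := eqVneq Y 0.
  by rewrite normr0 mulr0 !mulr_ge0.
rewrite -(ler_pM2r (_ : 0 < `|Y|)) ?normr_gt0// -[leLHS]mulrA -expr2.
apply: (le_trans (Ac _ Y)).
apply: (@le_trans _ _ (\tr (Y^T *m (A *m Y + Y *m B)))).
  rewrite mulmxDr !mulmxA linearD/= lerDl.
  exact/mxtrace_mul_psd_ge0/B0/possemidef_gram.
rewrite (le_trans (mxtrace_mul_le _ _))//; lra.
Qed.

Definition lyapunov A : 'M[R]_n -> 'M[R]_n := fun Y => A *m Y + Y *m A.

Fact lyapunov_is_linear A : linear (lyapunov A).
Proof.
move=> a Y Z; rewrite /lyapunov mulmxDr mulmxDl -scalemxAl -scalemxAr.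
by rewrite scalerDr addrACA.
Qed.
HB.instance Definition _ A :=
  GRing.isLinear.Build R _ _ _ (lyapunov A) (lyapunov_is_linear A).

Lemma lyapunov_inj A : posdef A -> injective (lyapunov A).
Proof.
move=> pA; apply: raddf_inj => Y AY.
have [c c0 Ac] := posdef_coercive pA.
have := lyapunov_bound Ac Y (posdef_psd pA); rewrite [_ + _]AY normr0 mulr0.
by rewrite pmulr_rle0// normr_le0 => /eqP.
Qed.

(** The solution operator of the Lyapunov equation, as the inverse of the
    matrix of [lyapunov A] acting on vectorized matrices. *)
Definition lyapunov_inv A : 'M[R]_n -> 'M[R]_n :=
  vec_mx \o mulmxr (invmx (lin_mx (lyapunov A))) \o mxvec.
HB.instance Definition _ A := GRing.Linear.on (lyapunov_inv A).

Lemma lyapunov_invK A : posdef A -> cancel (lyapunov_inv A) (lyapunov A).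
Proof.
move=> pA Z.
have uL : lin_mx (lyapunov A) \in unitmx.
  rewrite -row_free_unit -kermx_eq0; apply/eqP/row_matrixP => i.
  have : row i (kermx (lin_mx (lyapunov A))) *m lin_mx (lyapunov A) = 0.
    by rewrite -row_mul mulmx_ker row0.
  rewrite row0; move: (row i _) => v; rewrite -[v]vec_mxK mul_vec_lin.
  move=> /(canRL mxvecK); rewrite linear0; move: (vec_mx v) => Y AY.
  by rewrite (lyapunov_inj pA (etrans AY (esym (linear0 _)))) linear0.
apply: (can_inj mxvecK); rewrite -mul_vec_lin /lyapunov_inv /= vec_mxK.
by rewrite mulmxKV.
Qed.

Lemma trmx_lyapunov_inv A Z : posdef A -> Z^T = Z ->
  (lyapunov_inv A Z)^T = lyapunov_inv A Z.
Proof.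
move=> pA symZ; apply: (lyapunov_inj pA); rewrite lyapunov_invK//.
rewrite -[RHS]symZ -[in RHS](lyapunov_invK pA Z) /lyapunov.
by rewrite linearD /= !trmx_mul pA.1 addrC.
Qed.

(** Multiply the Lyapunov equation by [invmx A] and use the cyclicity of the
    trace; this is why differentiating the trace of a square root only involves
    its inverse. *)
Lemma mxtrace_lyapunov_inv A Z : posdef A ->
  2 * \tr (lyapunov_inv A Z) = \tr (invmx A *m Z).
Proof.
move=> pA; have uA := posdef_unit pA.
rewrite -[in RHS](lyapunov_invK pA Z) /lyapunov mulmxDr linearD /= mulKmx//.
by rewrite mulmxA mxtrace_mulC mulmxA mulmxV// mul1mx mulr_natl mulr2n.
Qed.

End Lyapunov.

(** The increment [Y] of the square root solves
    [P *m Y + Y *m Q = M - M0], hence is Lipschitz in [M]; its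
    deviation from the solution of the Lyapunov equation of [P] solves the same
    equation with right-hand side [- (Y *m Y)]. *)
Lemma psd_sqrt_expansion n (M0 : 'M[R]_n) : posdef M0 ->
  exists k, forall M, possemidef M ->
    `|psd_sqrt M - psd_sqrt M0 - lyapunov_inv (psd_sqrt M0) (M - M0)|
      <= k * `|M - M0| ^+ 2.
Proof.
move=> pM0; have [P0 PP] := psd_sqrtP (posdef_psd pM0).
have pP := psd_sqrt_posdef pM0.
have [c c0 /lyapunov_bound cP] := posdef_coercive pP.
set P := psd_sqrt M0 in P0 PP pP cP *.
pose a := n%:R * n%:R / c.
have a0 : 0 <= a by rewrite !mulr_ge0// invr_ge0 ltW.
have bound (B Y : 'M[R]_n) : possemidef B -> `|Y| <= a * `|P *m Y + Y *m B|.
  by move=> B0; rewrite /a mulrAC ler_pdivlMr// mulrC cP.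
clearbody a.
exists (a * n%:R * (a * a)) => M M_ge0; have [Q0 QQ] := psd_sqrtP M_ge0.
move: (psd_sqrt M) Q0 QQ => Q Q0 QQ.
pose Y := Q - P.
have YM : `|Y| <= a * `|M - M0|.
  rewrite (le_trans (bound Q _ Q0))// -QQ -PP /Y mulmxBr mulmxBl.
  by rewrite addrC subrKA.
rewrite -/Y; set L := lyapunov_inv _ _.
have LE : P *m L + L *m P = M - M0 := lyapunov_invK pP _.
rewrite (le_trans (bound P _ P0))//.
have -> : P *m (Y - L) + (Y - L) *m P = - (Y *m Y).
  rewrite mulmxBr mulmxBl addrACA -opprD LE -QQ -PP.
  rewrite /Y !mulmxBr !mulmxBl.
  by apply/matrixP => i j; rewrite !mxE; ring.
rewrite normrN -!mulrA ler_wpM2l//.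
rewrite (le_trans (ler_norm_mulmx _ _))// -mulrA.
by rewrite ler_wpM2l// [a * (a * _)]mulrA expr2 mulrACA ler_pM.
Qed.

(** A positive definite matrix is in general not interior to the set of positive
    semidefinite matrices among all square matrices, so positivity of [f] is
    assumed everywhere rather than deduced near [x]. *)
Lemma is_diff_psd_sqrt (V : normedModType R) n (f df : V -> 'M[R]_n) x :
  (forall t, possemidef (f t)) -> posdef (f x) -> is_diff x f df ->
  is_diff x (fun t => psd_sqrt (f t))
    (fun h => lyapunov_inv (psd_sqrt (f x)) (df h)).
Proof.
move=> f0 pfx fx; have [k kP] := psd_sqrt_expansion pfx.
set P := psd_sqrt (f x) in kP *; set L := lyapunov_inv P.
pose r t := psd_sqrt (f t) - P - L (f t - f x).
have [K K0 fP] := is_diff_lipschitz fx.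
have dr : is_diff x r (\0 : {linear V -> 'M[R]_n}).
  apply: (@is_diff_quadratic _ _ _ _ _ _ (`|k| * K ^+ 2)).
    exact: cst_continuous.
  near=> h; rewrite /r !subrr linear0 [L 0]linear0 addr0 !subr0.
  rewrite (le_trans (kP _ (f0 _)))//.
  apply: (@le_trans _ _ (`|k| * `|f (h + x) - f x| ^+ 2)).
    by rewrite ler_wpM2r ?sqr_ge0 ?ler_norm.
  rewrite -mulrA ler_wpM2l// -exprMn ler_sqr ?nnegrE ?mulr_ge0// ?(ltW K0)//.
  by near: h.
have -> : (fun t => psd_sqrt (f t)) = r + ((L \o f) + cst (P - L (f x))).
  rewrite funeqE => t; rewrite !fctE /r /L linearB /=.
  by apply/matrixP => i j; rewrite !mxE; ring.
have dL := is_diff_linear (lyapunov_inv P) (f x).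
apply: (is_diff_eq (is_diffD dr
  (is_diffD (is_diff_comp fx dL) (is_diff_cst _ _)))).
by rewrite funeqE => h; rewrite !fctE /= add0r addr0.
Unshelve. all: by end_near. Qed.

End SquareRootDifferential.

(** * The Hessian as the differential of the gradient *)

Section HessianOfGradient.
Context {R : realType} {m n : nat}.
Implicit Types (X Y V : 'M[R]_(m, n)).

Lemma vecK : cancel (@vec R m n) unvec.
Proof. by move=> X; rewrite /unvec /vec mxvecK trmxK. Qed.

Lemma unvecK : cancel (@unvec R m n) vec.
Proof. by move=> v; rewrite /unvec /vec trmxK vec_mxK. Qed.

Lemma vec_dot X Y : vec X *m (vec Y)^T = (\tr (X^T *m Y))%:M.
Proof.
apply/matrixP => i j; rewrite !ord1 !mxE eqxx mulr1n.
transitivity (\sum_j \sum_i X i j * Y i j).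
  rewrite (reindex _ (curry_mxvec_bij n m)) /= pair_bigA /=.
  by apply: eq_bigr => -[j0 i0] _ /=; rewrite /vec mxE !mxvecE !mxE.
by apply: eq_bigr => j0 _; rewrite mxE; apply: eq_bigr => i0 _; rewrite mxE.
Qed.

(** The Jacobian of the vectorized gradient is [dGr] read through [vec], and
    [vec] is an isometry for the trace inner product. *)
Lemma Hess_gradient (f : 'M[R]_(m, n) -> R) X Gr dGr :
    (\forall Y \near X, is_diff Y f (fun V => \tr ((Gr Y)^T *m V))) ->
    is_diff X Gr dGr ->
  twice_differentiable f X /\
  forall x y : 'cV[R]_(n * m), (x^T *m Hess f X *m y) 0 0 =
    \tr ((dGr (unvec y^T))^T *m unvec x^T).
Proof.
move=> fGr dG.
pose vecL : {linear 'M[R]_(m, n) -> 'rV[R]_(n * m)} := mxvec \o trmx.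
pose unvecL : {linear 'rV[R]_(n * m) -> 'M[R]_(m, n)} := trmx \o vec_mx.
have gradE : \forall Y \near X, gradient f Y = Gr Y.
  apply: filterS fGr => Y [fY dfY]; apply/matrixP => i j.
  rewrite mxE deriveE// dfY -(mul_delta_mx (0 : 'I_1)) mulmxA mxtrace_mulC.
  by rewrite mulmxA -colE -rowE /mxtrace big_ord1 !mxE.
have dg : is_diff (vec X) (vec_gradient f) (vecL \o (dGr \o unvecL)).
  apply: (@near_eq_is_diff _ _ _ _ (vecL \o (Gr \o unvecL))).
    have cu : unvecL @ vec X --> X.
      rewrite -[X in _ --> X]vecK.
      exact: (@matrix_linear_continuous R _ _ _ unvecL (vec X)).
    have gE : \forall v \near vec X, gradient f (unvec v) = Gr (unvec v).
      exact: cu _ gradE.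
    near=> v; rewrite /vec_gradient (_ : gradient f _ = Gr (unvec v))//.
    by near: v.
  have dGX : is_diff (unvecL (vec X)) Gr dGr by rewrite [unvecL _]vecK.
  exact: (is_diff_comp (is_diff_comp (is_diff_linear unvecL _) dGX)
    (is_diff_linear vecL _)).
split=> [|x y].
  split; last by case: dg.
  by apply: filterS fGr => Y [].
rewrite /Hess -[in LHS](trmxK x).
have -> : x^T^T^T *m ('J (vec_gradient f) (vec X))^T *m y =
    (y^T *m 'J (vec_gradient f) (vec X) *m x)^T.
  by rewrite !trmx_mul !trmxK mulmxA.
rewrite -deriveEjacobian; last by case: dg.
rewrite deriveE; last by case: dg.
rewrite diff_val mxE -[x in _ *m x]trmxK -[x^T]unvecK.
by rewrite [_ *m _]vec_dot mxE eqxx mulr1n unvecK.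
Unshelve. all: by end_near. Qed.

Lemma posdef_bilinear p (H : 'M[R]_p) (B : 'cV[R]_p -> 'cV[R]_p -> R) :
  (forall x y, (x^T *m H *m y) 0 0 = B x y) ->
  (forall x y, B x y = B y x) ->
  (forall x, x != 0 -> 0 < B x x) -> posdef H.
Proof.
move=> HB symB B0; split=> [|x x0]; last by rewrite HB B0.
apply/matrixP => i j; rewrite mxE.
have HE k l : H k l = B (delta_mx k 0) (delta_mx l 0).
  by rewrite -HB trmx_delta -mulmxA -colE -rowE !mxE.
by rewrite !HE symB.
Qed.

End HessianOfGradient.

(** * Contraction by the optimal transport map *)

Section TransportMap.
Context {R : realType} {n : nat}.

(** The matrix [T = D *m invmx P *m D] satisfies [T *m C *m T = D *m D].  If
    [1 - T] had an eigenvalue [a < 0], an eigenvector [v] would satisfy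
    [(1 - a) ^+ 2 * (v *m C *m v^T) <= v *m C *m v^T], a contradiction. *)
Lemma transport_contraction (C D P : 'M[R]_n) :
    posdef C -> posdef D -> posdef P -> P *m P = D *m C *m D ->
    loewner_ge C (D *m D) ->
  possemidef (1%:M - D *m invmx P *m D).
Proof.
move=> pC pD pP PP [_ CD]; have uP := posdef_unit pP.
set T := D *m invmx P *m D.
have symT : T^T = T.
  by rewrite /T !trmx_mul trmx_inv pD.1 pP.1 mulmxA.
have TCT : T *m C *m T = D *m D.
  have -> : T *m C *m T = D *m invmx P *m (D *m C *m D) *m invmx P *m D.
    by rewrite /T !mulmxA.
  by rewrite -PP !mulmxA mulmxKV// mulmxK.
clearbody T; apply: possemidefP; first by rewrite linearB /= tr_scalar_mx symT.
move=> a /eigenvalueP[v vT v0]; rewrite leNgt; apply/negP => a0.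
have vTE : v *m T = (1 - a) *: v.
  by apply/eqP; rewrite scalerBl scale1r -vT mulmxBr mulmx1 subKr.
have TvE : T *m v^T = (1 - a) *: v^T.
  by rewrite -[in LHS]symT -trmx_mul vTE linearZ.
have := CD v^T; rewrite trmxK -TCT mulmxBr mulmxBl !mulmxA vTE.
rewrite -!scalemxAl -[_ *m T *m v^T]mulmxA TvE -scalemxAr scalerA !mxE.
have := pC.2 v^T; rewrite trmx_eq0 trmxK => /(_ v0); rewrite !mxE.
nra.
Qed.

End TransportMap.

(** * First and second variations of the objective *)

Section Objective.
Context {R : realType} {n p q : nat}.
Variables (F : 'M[R]_(n, p)) (K : 'M[R]_(n, q)) (S : 'M[R]_p) (D : 'M[R]_n).
Variables (lam : R).
Hypotheses (pS : posdef S) (pD : posdef D) (lam_gt0 : 0 < lam).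
Implicit Types X Y V W : 'M[R]_(q, p).

(** This is Omega, with [K] standing for F H_u. *)
Definition outmx Y := F + K *m Y.
Definition outcov Y := outmx Y *m S *m (outmx Y)^T.
Definition fidsq Y := D *m outcov Y *m D.
(** The trace of this matrix is the fidelity term of the Wasserstein distance
    between Gaussians of covariances [outcov Y] and [D *m D]. *)
Definition fid Y := psd_sqrt (fidsq Y).
Definition dfidsq Y V :=
  D *m (K *m V *m S *m (outmx Y)^T + outmx Y *m S *m (K *m V)^T) *m D.

Definition half_grad Y := Y *m S + lam *: (K^T *m (outmx Y *m S))
  - lam *: (K^T *m D *m invmx (fid Y) *m (D *m (outmx Y *m S))).

Lemma is_diff_outmx Y : is_diff Y outmx (mulmx K).
Proof.
have d := is_diff_linear (mulmx K) Y.
apply: (is_diff_eq (is_diffD (is_diff_cst F Y) d)).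
by rewrite funeqE => V; rewrite !fctE add0r.
Qed.

Lemma is_diff_outcov Y : is_diff Y outcov
  (fun V => K *m V *m S *m (outmx Y)^T + outmx Y *m S *m (K *m V)^T).
Proof.
have dO := is_diff_outmx Y.
have dOS := is_diff_mulmx dO (is_diff_cst S Y).
have dOT := is_diff_comp dO (is_diff_linear (@trmx R n p) (outmx Y)).
apply: (is_diff_eq (is_diff_mulmx dOS dOT)).
by rewrite funeqE => V; rewrite !fctE /= mulmx0 addr0.
Qed.

Lemma is_diff_fidsq Y : is_diff Y fidsq (dfidsq Y).
Proof.
have dl := is_diff_linear (mulmx D) (outcov Y).
have dr := is_diff_linear (mulmxr D) (D *m outcov Y).
exact: (is_diff_comp (is_diff_comp (is_diff_outcov Y) dl) dr).
Qed.

Lemma possemidef_fidsq Y : possemidef (fidsq Y).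
Proof.
rewrite /fidsq -{1}pD.1; apply: possemidef_congr.
rewrite /outcov -{1}[outmx Y]trmxK; apply: possemidef_congr.
exact: posdef_psd.
Qed.

Lemma is_diff_fid Y : posdef (fidsq Y) ->
  is_diff Y fid (fun V => lyapunov_inv (fid Y) (dfidsq Y V)).
Proof.
by move=> pM; apply: is_diff_psd_sqrt possemidef_fidsq pM (is_diff_fidsq Y).
Qed.

Let sym_S : S^T = S. Proof. exact: pS.1. Qed.
Let sym_D : D^T = D. Proof. exact: pD.1. Qed.

(** [dfidsq Y V] is a matrix plus its transpose, and both contribute equally to
    the trace against a symmetric matrix. *)
Lemma mxtrace_dfidsq (Q : 'M[R]_n) Y V : Q^T = Q ->
  \tr (Q *m dfidsq Y V) =
  2 * \tr ((K^T *m D *m Q *m (D *m (outmx Y *m S)))^T *m V).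
Proof.
move=> symQ.
have cyc (Z : 'M[R]_n) : \tr (Q *m (D *m Z *m D)) = \tr (D *m Q *m D *m Z).
  by rewrite !mulmxA [LHS]mxtrace_mulC !mulmxA.
rewrite /dfidsq cyc mulmxDr linearD /=.
rewrite -[\tr (_ *m (outmx Y *m _ *m _))]mxtrace_tr.
rewrite [_ *m (outmx Y *m S)]mulmxA !trmx_mul !trmxK symQ sym_D sym_S.
rewrite [\tr (K *m V *m _ *m _)]mxtrace_mulC [RHS]mulr_natl mulr2n.
by congr (_ + _); rewrite !mulmxA -[in LHS]mulmxA mxtrace_mulC !mulmxA.
Qed.

Lemma is_diff_objective a b Sd Y : posdef (fidsq Y) ->
  is_diff Y (fun T => \tr (T *m S *m T^T) + a +
    lam * (b + \tr (outcov T + Sd) - 2 * \tr (fid T)))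
    (fun V => \tr ((2 *: half_grad Y)^T *m V)).
Proof.
move=> pM; have pP : posdef (fid Y) := psd_sqrt_posdef pM.
have d1 : is_diff Y (fun T => \tr (T *m S *m T^T))
    (fun V => \tr (V *m S *m Y^T + Y *m S *m V^T)).
  have dS := is_diff_linear (mulmxr S) Y.
  have dT := is_diff_linear (@trmx R q p) Y.
  exact: (is_diff_trace (is_diff_mulmx dS dT)).
have d2 := is_diff_trace (is_diff_outcov Y).
have d3 := is_diff_trace (is_diff_fid pM).
pose k : R := a + lam * (b + \tr Sd).
have -> : (fun T => \tr (T *m S *m T^T) + a +
    lam * (b + \tr (outcov T + Sd) - 2 * \tr (fid T))) =
    (fun T => \tr (T *m S *m T^T)) + lam *: (fun T => \tr (outcov T))
    - (lam * 2) *: (fun T => \tr (fid T)) + cst k.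
  rewrite funeqE => T; rewrite !fctE /k linearD /= /GRing.scale /=; ring.
apply: (is_diff_eq (is_diffD (is_diffB (is_diffD d1 (is_diffZ lam d2))
  (is_diffZ (lam * 2) d3)) (is_diff_cst _ _))).
rewrite funeqE => V; rewrite !fctE /= addr0.
have trT m (A : 'M[R]_(m, p)) (B : 'M[R]_(m, p)) :
    \tr (A *m S *m B^T) = \tr ((B *m S)^T *m A).
  by rewrite trmx_mul sym_S -mulmxA mxtrace_mulC.
have trC m (A : 'M[R]_(m, p)) (B : 'M[R]_(m, p)) :
    \tr (A *m S *m B^T) = \tr (B *m S *m A^T).
  by rewrite -mxtrace_tr !trmx_mul trmxK sym_S mulmxA.
have trD : \tr (invmx (fid Y) *m dfidsq Y V) =
    2 * \tr ((K^T *m D *m invmx (fid Y) *m (D *m (outmx Y *m S)))^T *m V).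
  by apply: mxtrace_dfidsq; rewrite trmx_inv pP.1.
have -> : \tr ((2 *: half_grad Y)^T *m V) = 2 * (\tr ((Y *m S)^T *m V) +
    lam * \tr ((K^T *m (outmx Y *m S))^T *m V) -
    lam * \tr ((K^T *m D *m invmx (fid Y) *m (D *m (outmx Y *m S)))^T *m V)).
  have linD c e (X1 X2 X3 : 'M[R]_(q, p)) :
      \tr ((2 *: (X1 + c *: X2 - e *: X3))^T *m V) =
      2 * (\tr (X1^T *m V) + c * \tr (X2^T *m V) - e * \tr (X3^T *m V)).
    rewrite linearZ linearB linearD 2!linearZ /= -scalemxAl linearZ /=.
    by rewrite mulmxBl mulmxDl -!scalemxAl linearB linearD /= !linearZ.
  exact: linD.
rewrite /GRing.scale /= -[lam * 2 * _]mulrA mxtrace_lyapunov_inv// trD.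
rewrite ![\tr (_ + _)]linearD /= (trC _ Y) (trC _ (outmx Y)) !trT.
rewrite [(K^T *m _)^T]trmx_mul trmxK -[_ *m K *m V]mulmxA.
ring.
Qed.

Definition dfid X V := lyapunov_inv (fid X) (dfidsq X V).
(** The matrix of the optimal transport map from the centered Gaussian of
    covariance [outcov X] to the one of covariance [D *m D]. *)
Definition transport X := D *m invmx (fid X) *m D.

Definition dhalf_grad X V := V *m S + lam *: (K^T *m (K *m V *m S))
  - lam *: (K^T *m D *m (- (invmx (fid X) *m dfid X V *m invmx (fid X)))
              *m (D *m (outmx X *m S))
            + K^T *m D *m invmx (fid X) *m (D *m (K *m V *m S))).

Lemma is_diff_half_grad X : posdef (fidsq X) ->
  is_diff X half_grad (dhalf_grad X).
Proof.
move=> pM; have pP : posdef (fid X) := psd_sqrt_posdef pM.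
have dS := is_diff_linear (mulmxr S) X.
have dO := is_diff_outmx X.
have dOS := is_diff_comp dO (is_diff_linear (mulmxr S) (outmx X)).
have d1 := is_diff_comp dOS (is_diff_linear (mulmx K^T) (outmx X *m S)).
have d2 := is_diff_comp dOS (is_diff_linear (mulmx D) (outmx X *m S)).
have d3 := is_diff_invmx (posdef_unit pP) (is_diff_fid pM).
have d4 := is_diff_comp d3 (is_diff_linear (mulmx (K^T *m D)) _).
exact: (is_diffB (is_diffD dS (is_diffZ lam d1))
  (is_diffZ lam (is_diff_mulmx d4 d2))).
Qed.

Lemma trmx_dfidsq X V : (dfidsq X V)^T = dfidsq X V.
Proof.
rewrite /dfidsq !trmx_mul linearD /= !trmx_mul !trmxK sym_S sym_D.
by rewrite addrC !mulmxA.
Qed.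

(** The Hessian form, arranged so that its symmetry and its sign can be read
    off term by term. *)
Definition second_variation X V W :=
  2 * \tr ((V *m S)^T *m W)
  + 2 * lam * \tr ((K *m V *m S)^T *m (1%:M - transport X) *m (K *m W))
  + lam * (\tr (invmx (fid X) *m (dfid X V *m dfid X W))
           + \tr (invmx (fid X) *m (dfid X W *m dfid X V))).

(** The term that comes from differentiating the inverse root is
    [\tr (Q *m dfidsq X W)] with [Q] the conjugate of [dfid X V] by the inverse
    root; expressing [dfidsq X W] through its Lyapunov equation makes it
    symmetric in [V] and [W]. *)
Lemma mxtrace_dhalf_grad X V W : posdef (fidsq X) ->
  \tr ((2 *: dhalf_grad X V)^T *m W) = second_variation X V W.
Proof.
move=> pM; have pP : posdef (fid X) := psd_sqrt_posdef pM.
have uP := posdef_unit pP.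
have symL : (dfid X V)^T = dfid X V.
  exact: trmx_lyapunov_inv pP (trmx_dfidsq X V).
have symI : (invmx (fid X))^T = invmx (fid X) by rewrite trmx_inv pP.1.
set Q := invmx (fid X) *m dfid X V *m invmx (fid X).
have symQ : Q^T = Q by rewrite /Q !trmx_mul symL symI mulmxA.
have trQ : \tr (Q *m dfidsq X W) =
    \tr (invmx (fid X) *m (dfid X V *m dfid X W)) +
    \tr (invmx (fid X) *m (dfid X W *m dfid X V)).
  rewrite -(lyapunov_invK pP (dfidsq X W)) -/(dfid X W) /lyapunov.
  rewrite mulmxDr linearD /=.
  rewrite /Q mulmxA mulmxKV// mulmxA; congr (_ + _); first by rewrite mulmxA.
  rewrite mulmxA mxtrace_mulC !mulmxA (mulmxV uP) mul1mx.
  by rewrite -[in LHS]mulmxA mxtrace_mulC.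
have linD c (X1 X2 X3 X4 : 'M[R]_(q, p)) :
    \tr ((2 *: (X1 + c *: X2 - c *: (- X3 + X4)))^T *m W) =
    2 * \tr (X1^T *m W) + 2 * c * (\tr (X2^T *m W) - \tr (X4^T *m W))
    + c * (2 * \tr (X3^T *m W)).
  rewrite [(2 *: _)^T]linearZ /= [(_ - _)^T]linearB /= [(X1 + _)^T]linearD /=.
  rewrite ![(c *: _)^T]linearZ /= [(- _ + _)^T]linearD /= [(- _)^T]linearN /=.
  rewrite -scalemxAl [\tr (2 *: _)]linearZ mulmxBl mulmxDl -!scalemxAl mulmxDl.
  rewrite mulNmx /= [\tr (_ - _)]linearB /= [\tr (_ + c *: _)]linearD /=.
  rewrite ![\tr (c *: _)]linearZ /= [\tr (- _ + _)]linearD /=.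
  by rewrite [\tr (- _)]linearN /=; ring.
rewrite /dhalf_grad -/(dfid X V) -/Q mulmxN mulNmx linD -mxtrace_dfidsq// trQ.
rewrite /second_variation mulmxBr mulmxBl mulmx1 [\tr (_ - _)]linearB /=.
by congr (_ + 2 * lam * (_ - _) + _); congr (\tr _);
  rewrite !trmx_mul !trmxK ?sym_D ?symI /transport !mulmxA.
Qed.

Lemma second_variation_sym X V W : posdef (fidsq X) ->
  second_variation X V W = second_variation X W V.
Proof.
move=> pM; have pP : posdef (fid X) := psd_sqrt_posdef pM.
rewrite /second_variation [X in _ + lam * X]addrC; congr (_ * _ + _ * _ + _).
  by rewrite -mxtrace_tr !trmx_mul trmxK !sym_S mulmxA mxtrace_mulC mulmxA.
rewrite -mxtrace_tr !trmx_mul !trmxK linearB /= trmx1 /transport !trmx_mul.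
by rewrite trmx_inv pP.1 sym_D sym_S !mulmxA mxtrace_mulC !mulmxA.
Qed.

Lemma second_variation_gt0 X V : posdef (fidsq X) ->
  possemidef (1%:M - transport X) -> V != 0 -> 0 < second_variation X V V.
Proof.
move=> pM T1 V0; have pP : posdef (fid X) := psd_sqrt_posdef pM.
have symL : (dfid X V)^T = dfid X V.
  exact: trmx_lyapunov_inv pP (trmx_dfidsq X V).
have trL : 0 <= \tr (invmx (fid X) *m (dfid X V *m dfid X V)).
  apply: mxtrace_mul_psd_ge0; first exact/posdef_psd/posdef_inv.
  by rewrite -{1}symL; exact: possemidef_gram.
apply: ltr_wpDr; first by rewrite mulr_ge0 ?(ltW lam_gt0)// addr_ge0.
apply: ltr_wpDr.
  rewrite !mulr_ge0 ?(ltW lam_gt0)//.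
  rewrite trmx_mul sym_S -!mulmxA mxtrace_mul_psd_ge0//.
    exact: posdef_psd.
  by rewrite mulmxA; exact: possemidef_congr.
rewrite mulr_gt0//; have [c c0 Sc] := posdef_coercive pS.
rewrite trmx_mul sym_S mxtrace_mulC mulmxA.
have := Sc _ V^T; rewrite trmxK; apply: lt_le_trans.
by rewrite mulr_gt0// exprn_gt0// normr_gt0 trmx_eq0.
Qed.

Lemma Hess_objective_posdef a b Sd X : loewner_ge (outcov X) (D *m D) ->
  let f := fun Y => \tr (Y *m S *m Y^T) + a +
    lam * (b + \tr (outcov Y + Sd) - 2 * \tr (fid Y)) in
  twice_differentiable f X /\ posdef (Hess f X).
Proof.
move=> hX f.
have pC : posdef (outcov X).
  split=> [|x x0]; first by rewrite /outcov !trmx_mul trmxK sym_S mulmxA.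
  rewrite -[outcov X](subrK (D *m D)) mulmxDr mulmxDl mxE.
  apply: ltr_wpDl; first exact: hX.2.
  suff pDD : posdef (D *m D) by exact: pDD.2.
  apply: possemidef_unit; last by rewrite unitmx_mul posdef_unit.
  by rewrite -{1}sym_D; exact: possemidef_gram.
have pM : posdef (fidsq X).
  rewrite /fidsq -{1}sym_D; apply: posdef_congr pC _ => y Dy0.
  by rewrite -[y](mulKmx (posdef_unit pD)) Dy0 mulmx0.
(* [fidsq Y] is always positive semidefinite, so it stays positive definite as
   long as it stays invertible, which is an open condition. *)
have nearM : \forall Y \near X, posdef (fidsq Y).
  have cM : fidsq Y @[Y --> X] --> fidsq X.
    by apply: differentiable_continuous; case: (is_diff_fidsq X).
  have uM : \forall Y \near X, fidsq Y \in unitmx.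
    exact: cM _ (near_unitmx (posdef_unit pM)).
  by apply: filterS uM => Y; exact: possemidef_unit (possemidef_fidsq Y).
have gradf : \forall Y \near X,
    is_diff Y f (fun V => \tr ((2 *: half_grad Y)^T *m V)).
  by apply: filterS nearM => Y; exact: is_diff_objective.
have dgrad :
    is_diff X (fun Y => 2 *: half_grad Y) (fun V => 2 *: dhalf_grad X V).
  exact: (is_diffZ 2 (is_diff_half_grad pM)).
have [fX HE] := Hess_gradient gradf dgrad; split=> //.
have {}HE x y : (x^T *m Hess f X *m y) 0 0 =
    second_variation X (unvec y^T) (unvec x^T).
  by rewrite HE mxtrace_dhalf_grad.
apply: (posdef_bilinear HE) => [x y|x x0]; first exact: second_variation_sym.
have [PX0 PP] := psd_sqrtP (possemidef_fidsq X).
apply: second_variation_gt0 => //.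
  exact: transport_contraction pC pD (psd_sqrt_posdef pM) PP hX.
apply: contra_neq x0 => vx0; apply: trmx_inj.
by rewrite -[x^T]unvecK vx0 /vec !linear0.
Qed.

End Objective.

(** * Positive definiteness of the stacked covariance *)

Section StackedCovariance.
Context {R : realType} {N nx nw : nat}.
Implicit Types (A : 'I_N -> 'M[R]_nx) (G : 'I_N -> 'M[R]_(nx, nw)).

Lemma Phi_diag A k : Phi A k k = 1%:M.
Proof.
rewrite /Phi big_pred0// => l; apply/negbTE/negP => /andP[kl lk].
by move: (leq_ltn_trans kl lk); rewrite ltnn.
Qed.

Lemma mxdiag_posdef (Sw : 'M[R]_nw) : posdef Sw ->
  posdef (\mxdiag_(j < N) Sw).
Proof.
move=> pSw; have psdw := (posdef_psd pSw).2.
split=> [|x x0].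
  by rewrite tr_mxdiag; apply: eq_mxdiag => j; exact: pSw.1.
rewrite -[x]submxcolK tr_mxcol mul_mxrow_mxdiag mul_mxrow_mxcol summxE.
rewrite lt0r sumr_ge0 ?andbT => [|j _]; last exact: psdw.
apply: contra x0; rewrite psumr_eq0 => [|j _]; last exact: psdw.
move=> /allP x0; apply/eqP; rewrite -[x]submxcolK -[0]submxcolK.
apply: eq_mxcol => j; rewrite submxcol0; apply/eqP.
apply: contraTT (x0 j (mem_index_enum j)) => /= xj0.
by rewrite gt_eqF// pSw.2.
Qed.

(** Look at the last nonzero block of [x].  If it has index [j.+1], the block of
    [(Hmx A G)^T *m x] of index [j] reduces to [(G j)^T] applied to it, as
    [Phi A j.+1 j.+1] is the identity, and [(G j)^T] is injective.  If it has
    index 0, it equals [(Gamma A)^T *m x]. *)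
Lemma stacked_noise_injective A G (x : 'cV[R]_(\sum_(i < N.+1) nx)) :
  (forall k, row_free (G k)) ->
  (Gamma A)^T *m x = 0 -> (Hmx A G)^T *m x = 0 -> x = 0.
Proof.
move=> hG Gx Hx; pose y i := submxcol x i.
suff y0 i : y i = 0.
  rewrite -[x]submxcolK -[0]submxcolK; apply: eq_mxcol => i.
  by rewrite submxcol0; exact: y0.
apply/eqP; apply: contraT => yi.
case: (@arg_maxnP _ i (fun k => y k != 0) (fun k : 'I_N.+1 => k : nat) yi).
move=> {i yi} i yi ymax.
have ygt (j : 'I_N.+1) : (i < j)%N -> y j = 0.
  move=> ij; apply/eqP; apply: contraTT ij => yj.
  by rewrite -leqNgt; exact: ymax.
have [i0|i_gt0] := posnP i.
  suff : y i = 0 by move/eqP; rewrite (negPf yi).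
  move: Gx; rewrite -[x]submxcolK /Gamma tr_mxcol mul_mxrow_mxcol.
  rewrite (bigD1 i)//= big1 => [|j ji]; last first.
    by rewrite [submxcol x j]ygt ?mulmx0// i0 lt0n -i0.
  by rewrite i0 Phi_diag trmx1 mul1mx addr0.
have jN : (i.-1 < N)%N by rewrite -ltnS prednK.
pose j := Ordinal jN.
move: Hx => /(congr1 (fun z => submxcol z j)); rewrite submxcol0.
rewrite -[x]submxcolK /Hmx tr_mxblock mul_mxblock_mxrow mxcolK.
rewrite (bigD1 i)//= prednK// leqnn big1 => [|k ki]; last first.
  case: (leqP i k) => [ik|_]; last by rewrite trmx0 mul0mx.
  rewrite [submxcol x k]ygt ?mulmx0//.
  by rewrite ltn_neqAle ik andbT eq_sym.
rewrite Phi_diag mul1mx addr0 => /(congr1 trmx).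
rewrite trmx_mul trmxK trmx0 => /eqP; rewrite mulmx_free_eq0//.
by rewrite trmx_eq0 (negPf yi).
Qed.

Lemma Stilde_posdef A G (S0 : 'M[R]_nx) (Sw : 'M[R]_nw) :
  (forall k, row_free (G k)) -> posdef S0 -> posdef Sw ->
  posdef (Stilde A G S0 Sw).
Proof.
move=> hG pS0 pSw; have pW := mxdiag_posdef pSw.
set W := \mxdiag_(j < N) Sw in pW.
have psd1 := possemidef_congr ((Gamma A)^T) (posdef_psd pS0).
have psd2 := possemidef_congr ((Hmx A G)^T) (posdef_psd pW).
rewrite !trmxK in psd1 psd2.
split=> [|x x0]; first by rewrite /Stilde linearD /= psd1.1 psd2.1.
rewrite mulmxDr mulmxDl mxE lt0r addr_ge0 ?(psd1.2 x) ?(psd2.2 x)// andbT.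
apply: contra x0; rewrite paddr_eq0 ?(psd1.2 x) ?(psd2.2 x)// => /andP[e1 e2].
have pd0 m (P : 'M[R]_m) (y : 'cV_m) :
    posdef P -> (y^T *m P *m y) 0 0 == 0 -> y = 0.
  move=> [_ pP] e; apply/eqP; apply: contraTT e => y0.
  by rewrite gt_eqF// pP.
apply/eqP/(@stacked_noise_injective A G x hG).
  by apply: (pd0 _ _ _ pS0); move: e1; rewrite trmx_mul trmxK !mulmxA.
by apply: (pd0 _ _ _ pW); move: e2; rewrite trmx_mul trmxK !mulmxA.
Qed.

End StackedCovariance.

Theorem theorem2 (R : realType) (N nx nu nw : nat)
    (hN : (1 <= N)%N) (hnx : (1 <= nx)%N) (hnu : (1 <= nu)%N)
    (hnw : (1 <= nw)%N)
    (A : 'I_N -> 'M[R]_nx) (B : 'I_N -> 'M[R]_(nx, nu))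
    (G : 'I_N -> 'M[R]_(nx, nw)) (hG : forall k, row_free (G k))
    (mu0 mud : 'cV[R]_nx) (S0 Sd : 'M[R]_nx) (Sw : 'M[R]_nw)
    (hS0 : posdef S0) (hSd : posdef Sd) (hSw : posdef Sw)
    (lambda : R) (hlambda : 0 < lambda)
    (uff : 'cV[R]_(\sum_(j < N) nu))
    (Theta : 'M[R]_(\sum_(j < N) nu, \sum_(i < N.+1) nx))
    (hTheta : loewner_ge (terminal_cov A B G S0 Sw Theta) Sd) :
  twice_differentiable (J A B G mu0 mud S0 Sd Sw lambda uff) Theta /\
  posdef (Hess (J A B G mu0 mud S0 Sd Sw lambda uff) Theta).
Proof.
have pS := Stilde_posdef A hG hS0 hSw.
have [_ DD] := psd_sqrtP (posdef_psd hSd).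
pose K := Fmx *m Hmx A B.
have OmegaE T : Omega A B T = outmx Fmx K T.
  by rewrite /Omega /outmx mulmxDr mulmx1 mulmxA.
have covE T : terminal_cov A B G S0 Sw T = outcov Fmx K (Stilde A G S0 Sw) T.
  by rewrite /terminal_cov OmegaE.
have [] := @Hess_objective_posdef R _ _ _ Fmx K _ _ lambda pS
  (psd_sqrt_posdef hSd) hlambda (sqnorm2 uff)
  (sqnorm2 (mud - Fmx *m (Gamma A *m mu0 + Hmx A B *m uff))) Sd Theta.
  by rewrite DD -covE.
rewrite (_ : (fun T => _) = J A B G mu0 mud S0 Sd Sw lambda uff)//.
by rewrite funeqE => T; rewrite /J /W2sq covE.
Qed.
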